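(* Let $\mathbb{G}=(\Lambda,E)$ be any finite graph and let $\beta>0$. Then the arboreal gas on $\mathbb{G}$ with parameter $\beta$, regarded as a probability measure on $\{0,1\}^E$, is stochastically dominated by Bernoulli bond percolation on $\mathbb{G}$ with parameter $p_\beta=\beta/(1+\beta)$.
   Context: A forest is a subgraph $F=(\Lambda,E')$, $E'\subset E$, containing no cycles, and $|F|$ is its number of edges. The arboreal gas with parameter $\beta$ is the probability measure on forests with $\mathbb{P}_\beta[F]=\beta^{|F|}/\sum_{F'}\beta^{|F'|}$, the sum being over all forests. Stochastic domination of $\mu_2$ by $\mu_1$ on $\{0,1\}^E$ means $\mu_2(f)\le\mu_1(f)$ for all functions $f$ that are increasing for the coordinatewise order. *)

(* Defs.v *)
From HB Require Import structures.
From mathcomp Require Import all_boot all_order all_algebra.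
From mathcomp Require Import boolp reals.

Set Implicit Arguments.
Unset Strict Implicit.
Unset Printing Implicit Defensive.

Import Order.TTheory GRing.Theory Num.Theory.
Local Open Scope ring_scope.

(* Parallel edges and loops are allowed: a loop at v is an edge with
   ends [set v].  A simple graph is the case where [ends] is injective and
   takes its values in the sets of cardinal 2. *)
Record multigraph := Multigraph {
  vertex : finType;
  edge : finType;
  ends : edge -> {set vertex};
  ends_card : forall e, (0 < #|ends e| <= 2)%N }.

(* {0,1}^E; w is identified with the spanning subgraph (vertex G, {e | w e}). *)
Definition config (G : multigraph) := {ffun edge G -> bool}.

Section Forest.
Variable G : multigraph.
Implicit Types (w : config G) (c : seq (vertex G * edge G)).

Definition open_edges w : {set edge G} := [set e | w e].

(* [:: (v_1, e_1); ...; (v_k, e_k)], k >= 1, is a cycle if the v_i are pairwise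
   distinct, the e_i are pairwise distinct and e_i joins v_i to v_(i+1), with
   v_(k+1) = v_1.  A loop is a cycle with k = 1, two parallel edges form a
   cycle with k = 2; distinctness of the e_i rules out traversing a single edge
   back and forth. *)
Definition is_cycle c : bool :=
  [&& c != [::],
      cycle (fun s t => ends s.2 == [set s.1; t.1]) c,
      uniq (unzip1 c) & uniq (unzip2 c)].

Definition is_forest w : bool :=
  `[< ~ exists2 c, is_cycle c & all (fun s => s.2 \in open_edges w) c >].

End Forest.

Section Measures.
Variables (R : realType) (G : multigraph).
Implicit Types (mu : config G -> R) (f : config G -> R) (w : config G).

(* A measure on the finite set {0,1}^E is given by its mass function. *)
Definition is_probability mu : Prop :=
  (forall w, 0 <= mu w) /\ \sum_w mu w = 1.

Definition expectation mu f : R := \sum_w mu w * f w.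

Definition increasing f : Prop :=
  forall w w', (forall e, (w e <= w' e)%O) -> f w <= f w'.

Definition stochastically_dominated mu2 mu1 : Prop :=
  forall f, increasing f -> expectation mu2 f <= expectation mu1 f.

Definition arboreal_Z (beta : R) : R :=
  \sum_(w : config G | is_forest w) beta ^+ #|open_edges w|.

Definition arboreal_gas (beta : R) : config G -> R := fun w =>
  if is_forest w then beta ^+ #|open_edges w| / arboreal_Z beta else 0.

Definition bernoulli_percolation (p : R) : config G -> R := fun w =>
  \prod_(e : edge G) (if w e then p else 1 - p).

Lemma forest_empty : is_forest ([ffun=> false] : config G).
Proof.
apply/asboolP => -[[|s c] //= _].
by rewrite inE ffunE.
Qed.

Lemma arboreal_Z_gt0 (beta : R) : 0 < beta -> 0 < arboreal_Z beta.
Proof.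
move=> beta_gt0; rewrite /arboreal_Z (bigD1 _ forest_empty) /=.
apply: ltr_wpDr; last exact: exprn_gt0.
by apply: sumr_ge0 => w _; apply/exprn_ge0/ltW.
Qed.

Lemma arboreal_gas_probability (beta : R) :
  0 < beta -> is_probability (arboreal_gas beta).
Proof.
move=> beta_gt0; have Z_gt0 := arboreal_Z_gt0 beta_gt0; split => [w|].
  rewrite /arboreal_gas; case: ifP => // _.
  by apply: divr_ge0; [apply/exprn_ge0/ltW|exact: ltW].
by rewrite /arboreal_gas -big_mkcond /= -mulr_suml divff// gt_eqF.
Qed.

Lemma bernoulli_percolation_probability (p : R) :
  0 <= p <= 1 -> is_probability (bernoulli_percolation p).
Proof.
move=> /andP[p_ge0 p_le1]; split => [w|].
  by apply: prodr_ge0 => e _; case: ifP => // _; rewrite subr_ge0.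
rewrite /bernoulli_percolation.
rewrite -(bigA_distr_bigA (fun (_ : edge G) (b : bool) => if b then p else 1 - p)).
by rewrite big1// => e _; rewrite big_bool /= addrC subrK.
Qed.

End Measures.

Arguments arboreal_Z {R} G beta.
Arguments arboreal_gas {R} G beta w.
Arguments bernoulli_percolation {R} G p w.

(* Main.v *)
(** Bernoulli percolation conditioned to be a forest is the arboreal gas, and being
    a forest is a decreasing event, so the domination is an instance of the
    Harris inequality.  Harris is obtained by averaging the coordinates out one
    at a time: Chebyshev's two-point inequality handles each averaging step, and
    averaging preserves both expectations and monotonicity. *)
Require Import Defs.
From mathcomp Require Import all_boot all_order all_algebra.
From mathcomp Require Import boolp reals.
From mathcomp Require Import ring.

Import Order.TTheory GRing.Theory Num.Theory.
Local Open Scope ring_scope.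

Section Harris.
Context {R : realType} {G : multigraph}.
Implicit Types (w : config G) (e : edge G) (b : bool) (f g : config G -> R).

Definition set_edge e b w : config G := [ffun x => if x == e then b else w x].

Lemma set_edge_at e b w : set_edge e b w e = b.
Proof. by rewrite ffunE eqxx. Qed.

Lemma set_edge_id e w : set_edge e (w e) w = w.
Proof. by apply/ffunP => x; rewrite ffunE; case: eqP => // ->. Qed.

Lemma set_edgeK e b c w : set_edge e b (set_edge e c w) = set_edge e b w.
Proof. by apply/ffunP => x; rewrite !ffunE; case: eqP. Qed.

Lemma increasing_set_edge f e b :
  increasing f -> increasing (fun w => f (set_edge e b w)).
Proof.
by move=> finc w w' ww'; apply: finc => x; rewrite !ffunE; case: eqP.
Qed.

Lemma increasing_closed_open f e w :
  increasing f -> f (set_edge e false w) <= f (set_edge e true w).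
Proof. by move=> finc; apply: finc => x; rewrite !ffunE; case: eqP. Qed.

(** Pairs each configuration open at [e] with the one obtained by closing [e], so that an identity
    about averaging over [e] can be checked pair by pair. *)
Lemma sum_config_split (h : config G -> R) e :
  \sum_w h w = \sum_(w : config G | w e) (h w + h (set_edge e false w)).
Proof.
rewrite (bigID (fun w : config G => w e)) /= big_split /=; congr (_ + _).
rewrite (reindex_onto (set_edge e false) (set_edge e true)) /=; last first.
  by move=> w /negbTE we; rewrite set_edgeK -we set_edge_id.
apply: eq_bigl => w; rewrite set_edge_at set_edgeK /=.
apply/eqP/idP => [<-|we]; first by rewrite set_edge_at.
by rewrite -[in LHS]we set_edge_id.
Qed.

Variables (p : R) (p01 : 0 <= p <= 1).

(** Conditional expectation of [f] given the states of all edges other than [e]. *)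
Definition average e f w : R :=
  p * f (set_edge e true w) + (1 - p) * f (set_edge e false w).

Lemma average_mono f g e w :
  (forall w', f w' <= g w') -> average e f w <= average e g w.
Proof.
case/andP: p01 => p0 p1 fg.
by rewrite lerD // ler_wpM2l // subr_ge0.
Qed.

Lemma increasing_average f e : increasing f -> increasing (average e f).
Proof.
case/andP: p01 => p0 p1 finc w w' ww'.
by rewrite lerD // ler_wpM2l ?subr_ge0 //; exact: increasing_set_edge.
Qed.

(** With the other edges frozen, the gap is the covariance of two functions of one Bernoulli
    variable: [p * (1 - p)] times the product of their increments, both nonnegative. *)
Lemma average_correlation f g e w : increasing f -> increasing g ->
  average e f w * average e g w <= average e (fun w' => f w' * g w') w.
Proof.
case/andP: p01 => p0 p1 finc ginc; rewrite /average -subr_ge0.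
have := increasing_closed_open f e w finc.
have := increasing_closed_open g e w ginc.
set f0 := f (set_edge e false w); set f1 := f (set_edge e true w).
set g0 := g (set_edge e false w); set g1 := g (set_edge e true w) => gm fm.
rewrite (_ : _ - _ = p * (1 - p) * ((f1 - f0) * (g1 - g0))); last by ring.
by rewrite !mulr_ge0 // subr_ge0.
Qed.

(** Within a pair differing only at [e], the weights are [p] and [1 - p] times a common product over
    the other edges, and [average e f] takes one value on both. *)
Lemma expectation_average f e :
  expectation (bernoulli_percolation G p) (average e f) =
  expectation (bernoulli_percolation G p) f.
Proof.
rewrite /expectation (sum_config_split _ e) [RHS](sum_config_split _ e).
apply: eq_bigr => w we.
rewrite /bernoulli_percolation (bigD1 e) //= we.
rewrite [X in _ + X * _](bigD1 e) //= set_edge_at.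
rewrite [X in _ = _ + X * _](bigD1 e) //= set_edge_at.
have -> : \prod_(i | i != e) (if set_edge e false w i then p else 1 - p) =
          \prod_(i | i != e) (if w i then p else 1 - p).
  by apply: eq_bigr => x /negbTE xe; rewrite ffunE xe.
rewrite /average !set_edgeK.
by have -> : set_edge e true w = w; [rewrite -[in LHS]we set_edge_id|ring].
Qed.

Definition average_seq (s : seq (edge G)) f := foldr average f s.

Lemma increasing_average_seq s f : increasing f -> increasing (average_seq s f).
Proof. by move=> finc; elim: s => //= e s; exact: increasing_average. Qed.

Lemma average_seq_correlation s f g w : increasing f -> increasing g ->
  average_seq s f w * average_seq s g w <=
  average_seq s (fun w' => f w' * g w') w.
Proof.
move=> finc ginc; elim: s w => //= e s IHs w.
(* The induction hypothesis passes under the outer average; the two-point inequality then applies to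
   the inner averages, which are still increasing. *)
apply: le_trans (average_mono _ _ e w IHs).
by apply: average_correlation; exact: increasing_average_seq.
Qed.

(** Each averaging erases the dependence on its edge; once [s] lists every edge, the result is
    constant. *)
Lemma average_seq_local s f w w' :
  {in [predC s], w =1 w'} -> average_seq s f w = average_seq s f w'.
Proof.
elim: s w w' => [|e s IHs] w w' ww'; first by congr f; apply/ffunP => x; exact: ww'.
rewrite /= /average; congr (_ * _ + _ * _); apply: IHs => x xs;
  by rewrite !ffunE; case: eqP => // /eqP xe; apply: ww'; rewrite !inE negb_or xe.
Qed.

Lemma average_seq_enum f w :
  average_seq (enum (edge G)) f w = expectation (bernoulli_percolation G p) f.
Proof.
have <- : expectation (bernoulli_percolation G p)
    (average_seq (enum (edge G)) f) = expectation (bernoulli_percolation G p) f.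
  by elim: (enum _) => //= e s <-; exact: expectation_average.
(* The fully averaged function is constant, hence equal to its expectation because the total mass is
   1. *)
rewrite /expectation (eq_bigr (fun w' =>
  bernoulli_percolation G p w' * average_seq (enum (edge G)) f w)).
  by rewrite -mulr_suml (bernoulli_percolation_probability G p01).2 mul1r.
move=> w' _; congr (_ * _); apply: average_seq_local => x.
by rewrite !inE mem_enum.
Qed.

Lemma harris f g : increasing f -> increasing g ->
  expectation (bernoulli_percolation G p) f *
  expectation (bernoulli_percolation G p) g <=
  expectation (bernoulli_percolation G p) (fun w => f w * g w).
Proof.
move=> finc ginc; rewrite -!(average_seq_enum _ [ffun=> false]).
exact: average_seq_correlation.
Qed.

End Harris.

Lemma is_forest_sub {G : multigraph} (w w' : config G) :
  (forall e, (w e <= w' e)%O) -> is_forest w' -> is_forest w.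
Proof.
move=> ww' /asboolP forest_w'; apply/asboolP => -[c c_cycle c_open].
apply: forest_w'; exists c => //; apply: sub_all c_open => s.
by rewrite !inE => ws; have := ww' s.2; rewrite ws; case: (w' _).
Qed.

(** As [1 - p = 1 / (1 + beta)], all edges share one denominator; on forests the weight is thus
    proportional to that of the arboreal gas. *)
Lemma bernoulli_percolation_odds {R : realType} (G : multigraph) (beta : R)
    (w : config G) : 0 < beta ->
  bernoulli_percolation G (beta / (1 + beta)) w =
  beta ^+ #|open_edges w| / (1 + beta) ^+ #|edge G|.
Proof.
move=> beta_gt0; have nz : 1 + beta != 0 by rewrite gt_eqF // addr_gt0.
rewrite /bernoulli_percolation.
rewrite (eq_bigr (fun e => (if w e then beta else 1) / (1 + beta))); last first.
  by move=> e _; case: ifP => // _; field.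
rewrite big_split /= -big_mkcond /= !prodr_const exprVn; congr (beta ^+ _ / _).
by apply: eq_card => e; rewrite inE.
Qed.

Theorem proposition1p1 (R : realType) (G : multigraph) (beta : R)
    (beta_gt0 : 0 < beta) :
  stochastically_dominated (arboreal_gas G beta)
    (bernoulli_percolation G (beta / (1 + beta))).
Proof.
move=> f finc; set p := beta / (1 + beta).
have beta1_gt0 : 0 < 1 + beta by rewrite addr_gt0.
have p01 : 0 <= p <= 1.
  apply/andP; split; first by apply: divr_ge0; exact: ltW.
  by rewrite /p ler_pdivrMr // mul1r lerDr.
(* The minus sign turns the indicator of a decreasing event into an increasing function. *)
pose g (w : config G) : R := - (is_forest w)%:R.
have ginc : increasing g.
  move=> w w' ww'; rewrite lerN2 ler_nat.
  by case: (boolP (is_forest w')) => // /(is_forest_sub _ _ ww') ->.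
pose C := (1 + beta) ^+ #|edge G|.
have C_gt0 : 0 < C by exact: exprn_gt0.
have Z_gt0 := arboreal_Z_gt0 G beta_gt0.
(* [arboreal_Z G beta / C] is the percolation probability of being a forest. *)
have Eg : expectation (bernoulli_percolation G p) g = - (arboreal_Z G beta / C).
  rewrite /expectation /arboreal_Z mulr_suml -sumrN [RHS]big_mkcond /=.
  apply: eq_bigr => w _; rewrite bernoulli_percolation_odds // /g -/C.
  by case: is_forest; rewrite ?oppr0 ?mulr0 // mulrN1.
(* On forests the percolation weight is that probability times the arboreal gas weight; elsewhere
   [g] vanishes. *)
have Efg : expectation (bernoulli_percolation G p) (fun w => f w * g w) =
    - (arboreal_Z G beta / C * expectation (arboreal_gas G beta) f).
  rewrite /expectation mulr_sumr -sumrN.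
  apply: eq_bigr => w _; rewrite bernoulli_percolation_odds // /g -/C.
  rewrite /arboreal_gas; case: is_forest; last by rewrite oppr0 !(mulr0, mul0r) oppr0.
  by rewrite mulr1n; field; rewrite !gt_eqF.
have := harris p p01 f g finc ginc.
(* Removing the common sign reverses the inequality, and the positive forest probability cancels. *)
by rewrite Eg Efg mulrN lerN2 [leRHS]mulrC ler_pM2l // divr_gt0.
Qed.
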